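(* Fix integers $K\ge 3$, $n\ge 1$ and $d\ge 1$. Suppose that $f:\Omega_K^n\to\mathbf{C}$ is of degree at most $d$ and $\|f\|_{\Omega_K^n}\le 1$. Then for any $\epsilon>0$ there exists a $k$-junta $g:\Omega_K^n\to\mathbf{C}$ such that $$\|f-g\|_2\le\epsilon\qquad\text{with}\qquad k\le\frac{d\left(\mathrm{BH}^{\le d}_{\Omega_K}\right)^{2d}}{\epsilon^{2d}}.$$ Moreover, if $K$ is prime, we may choose $k\le \epsilon^{-2d}\,d\,C_K^{d^3}$, for some constant $C_K$ depending only on $K$.
   Context: $\Omega_K=\{1,\omega,\dots,\omega^{K-1}\}$ with $\omega=e^{2\pi i/K}$. Every $f:\Omega_K^n\to\mathbf{C}$ has a unique expansion $f(z)=\sum_{\alpha\in\{0,1,\dots,K-1\}^n}a_\alpha z^\alpha$, $z^\alpha=z_1^{\alpha_1}\cdots z_n^{\alpha_n}$; put $|\alpha|=\alpha_1+\dots+\alpha_n$ (sum of integers, not mod $K$). $f$ is of degree at most $d$ if $a_\alpha=0$ whenever $|\alpha|>d$. $\|f\|_{\Omega_K^n}=\sup_{z\in\Omega_K^n}|f(z)|$, and $\|f\|_2$ is the $L^2$-norm with respect to the uniform probability measure on $\Omega_K^n$. A function on $\Omega_K^n$ is a $k$-junta if it depends on at most $k$ of the $n$ coordinates. $\mathrm{BH}^{\le d}_{\Omega_K}$ denotes the best (smallest) constant $C$ such that for all $n\ge1$ and all $f=\sum_{|\alpha|\le d}a_\alpha z^\alpha$ on $\Omega_K^n$ of degree at most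 $d$ one has $\big(\sum_\alpha|a_\alpha|^{2d/(d+1)}\big)^{(d+1)/(2d)}\le C\|f\|_{\Omega_K^n}$. *)

(* Defs.v *)
(* MathComp-Analysis, with the complex numbers [R[i]] over [R : realType]
   provided by mathcomp-real-closed. *)
From HB Require Import structures.
From mathcomp Require Import all_boot all_order all_algebra.
From mathcomp Require Import all_classical all_reals all_analysis.
From mathcomp Require Import complex.

Set Implicit Arguments.
Unset Strict Implicit.
Unset Printing Implicit Defensive.

Import Order.TTheory GRing.Theory Num.Theory.
Import ComplexField.Normc.

Local Open Scope classical_set_scope.
Local Open Scope ring_scope.
Local Open Scope complex_scope.

(* e^(2 pi i / K) *)
Definition omega (R : realType) (K : nat) : R[i] :=
  cos (2 * pi / K%:R) +i* sin (2 * pi / K%:R).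

Definition Omega (R : realType) (K : nat) : seq R[i] :=
  [seq omega R K ^+ j | j <- iota 0 K].

(* Omega_K^n, as a finite type; the coercion [ssval] sends each coordinate to
   the complex number that it is. *)
Definition cube (R : realType) (K n : nat) : finType :=
  {ffun 'I_n -> seq_sub (Omega R K)}.

Definition multiindex (K n : nat) : finType := {ffun 'I_n -> 'I_K}.

(* The sum is taken in nat, not modulo K. *)
Definition mdegree (K n : nat) (alpha : multiindex K n) : nat :=
  (\sum_(i < n) alpha i)%N.

Definition monomial (R : realType) (K n : nat) (alpha : multiindex K n)
    (z : cube R K n) : R[i] :=
  \prod_(i < n) ssval (z i) ^+ alpha i.

Definition expansion (R : realType) (K n : nat) (a : multiindex K n -> R[i])
    (z : cube R K n) : R[i] :=
  \sum_(alpha : multiindex K n) a alpha * monomial alpha z.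

Definition supported_le (R : realType) (K n d : nat)
    (a : multiindex K n -> R[i]) : Prop :=
  forall alpha : multiindex K n, (d < mdegree alpha)%N -> a alpha = 0.

(* The coefficient family of f is unique, so that "some" expansion of f is
   "the" expansion of f. *)
Definition degree_le (R : realType) (K n d : nat)
    (f : cube R K n -> R[i]) : Prop :=
  exists a : multiindex K n -> R[i],
    (forall z, f z = expansion a z) /\ supported_le d a.

Definition supnorm (R : realType) (K n : nat) (f : cube R K n -> R[i]) : R :=
  sup (range (fun z => normc (f z))).

(* L^2 norm for the uniform probability measure on the finite set Omega_K^n. *)
Definition l2norm (R : realType) (K n : nat) (f : cube R K n -> R[i]) : R :=
  Num.sqrt ((\sum_(z : cube R K n) normc (f z) ^+ 2) / #|cube R K n|%:R).

Definition junta (R : realType) (K n k : nat) (g : cube R K n -> R[i]) : Prop :=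
  exists2 S : {set 'I_n}, (#|S| <= k)%N &
    forall z w : cube R K n, (forall i, i \in S -> z i = w i) -> g z = g w.

(* (sum_alpha |a_alpha|^(2d/(d+1)))^((d+1)/(2d)) *)
Definition BHnorm (R : realType) (K n d : nat) (a : multiindex K n -> R[i]) : R :=
  (\sum_(alpha : multiindex K n)
     normc (a alpha) `^ ((2 * d)%:R / d.+1%:R)) `^ (d.+1%:R / (2 * d)%:R).

Definition BHadmissible (R : realType) (K d : nat) (C : R) : Prop :=
  forall (n : nat) (a : multiindex K n -> R[i]),
    (0 < n)%N -> supported_le d a ->
    BHnorm d a <= C * supnorm (expansion (R := R) a).

(* Least admissible constant, taken in the extended reals so that it is +oo
   (and not a junk value) in case no finite constant is admissible. *)
Definition BH (R : realType) (K d : nat) : \bar R :=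
  ereal_inf [set C%:E | C in [set C : R | BHadmissible K d C]].

(* Main.v *)
(* For the first part, threshold the coefficients: by the Bohnenblust-Hille
   inequality few of them exceed [delta = eps^(d+1) / BH^d], each of those
   involves at most [d] coordinates, and by Parseval the others contribute at
   most [eps^2] to the squared L^2 norm.

   The second part bypasses the Bohnenblust-Hille inequality.  Let [E_i] be the
   average over the i-th coordinate and [D_i = 1 - E_i].  For a real [f] of degree at most [d] with [|f| <= 1] and a
   set [s] of coordinates, [t |-> prod_(i in s) (1 - t D_i) f z] is a polynomial
   of degree at most [d], bounded by 1 on [[0, 1]] because
   [1 - t D_i = (1 - t) + t E_i] is an averaging operator; hence its linear
   coefficient [- sum_(i in s) D_i f z] is bounded in terms of [d] only, and so
   is [sum_i |D_i f z|].  Since hypercontractivity bounds [|D_i f|_2] by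
   [C^d |D_i f|_1], it follows that [M = sum_i |D_i f|_2] is bounded
   independently of [n].  Averaging out every coordinate with
   [|D_i f|_2 <= eps^2 / M] costs at most [eps^2] in squared norm and leaves at
   most [M^2 / eps^2] coordinates. *)
Require Import Defs.
From HB Require Import structures.
From mathcomp Require Import all_boot all_order all_algebra.
From mathcomp Require Import all_classical all_reals all_analysis.
From mathcomp Require Import complex.
From mathcomp Require Import ring lra.

Set Implicit Arguments.
Unset Strict Implicit.
Unset Printing Implicit Defensive.

Import Order.TTheory GRing.Theory Num.Theory.

Local Open Scope ring_scope.
Local Open Scope complex_scope.

(** * Linear coefficient of a polynomial bounded on [0, 1] *)

Section CoefficientBound.
Variable R : realFieldType.

(** Induction on the degree. For p of degree at most d+2, the polynomial q(t) = p(t) - 2^(d+2)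
    p(t/2) has no term of degree d+2, is bounded by (1 + 2^(d+2)) M on [0, 1], and has the linear
    coefficient of p times 1 - 2^(d+1). The sum has m+2 terms so that index 1 always occurs in
    it. *)
Lemma linear_coef_bound (d m : nat) (c : nat -> R) (M : R) :
  (forall k, (d < k)%N -> c k = 0) ->
  (forall t : R, 0 <= t <= 1 -> `|\sum_(k < m.+2) c k * t ^+ k| <= M) ->
  `|c 1%N| <= 5 ^+ d * M.
Proof.
have M_ge0 (c' : nat -> R) (M' : R) :
    (forall t : R, 0 <= t <= 1 -> `|\sum_(k < m.+2) c' k * t ^+ k| <= M') ->
  0 <= M'.
  by move=> /(_ 0); rewrite lexx ler01 => /(_ isT); apply: le_trans.
case: d => [|d] c_gt cM; first by rewrite c_gt// normr0 mul1r (M_ge0 c).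
elim: d c M c_gt cM => [|d IHd] c M c_gt cM.
  have cE t : \sum_(k < m.+2) c k * t ^+ k = c 0%N + c 1%N * t.
    rewrite !big_ord_recl big1 ?addr0 ?mulr1// => k _.
    by rewrite c_gt ?mul0r.
  have := cM 1; have := cM 0.
  rewrite !cE ler01 !lexx mulr0 mulr1 addr0 => /(_ isT) h0 /(_ isT) h1.
  have -> : c 1%N = (c 0%N + c 1%N) - c 0%N by ring.
  by apply: le_trans (ler_normB _ _) _; have := M_ge0 _ _ cM; lra.
have := M_ge0 _ _ cM => M0.
pose q k := c k * (1 - 2 ^+ d.+2 / 2 ^+ k).
have qM t : 0 <= t <= 1 -> `|\sum_(k < m.+2) q k * t ^+ k| <= (1 + 2 ^+ d.+2) * M.
  move=> /andP[t0 t1].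
  have -> : \sum_(k < m.+2) q k * t ^+ k = \sum_(k < m.+2) c k * t ^+ k
      - 2 ^+ d.+2 * \sum_(k < m.+2) c k * (t / 2) ^+ k.
    rewrite mulr_sumr -sumrB; apply: eq_bigr => k _.
    by rewrite /q expr_div_n; ring.
  apply: le_trans (ler_normB _ _) _; rewrite normrM normrX ger0_norm//.
  rewrite mulrDl mul1r lerD ?cM ?t0//.
  by rewrite ler_wpM2l ?exprn_ge0// cM//; apply/andP; split; lra.
have q_gt k : (d.+1 < k)%N -> q k = 0.
  rewrite leq_eqVlt => /predU1P[<-|/c_gt ck]; last by rewrite /q ck mul0r.
  by rewrite /q mulfV ?subrr ?mulr0 ?expf_neq0 ?pnatr_eq0.
have := IHd q _ q_gt qM.
rewrite /q expr1 normrM.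
have e1 : (1 : R) <= 2 ^+ d by rewrite exprn_ege1// ler1n.
have -> : 1 - 2 ^+ d.+2 / 2 = - (2 * 2 ^+ d - 1) :> R by rewrite !exprS; field.
rewrite normrN [X in _ * X <= _]ger0_norm; last lra.
set A := `|_|; have A0 : 0 <= A by exact: normr_ge0.
have -> : 2 ^+ d.+2 = 4 * 2 ^+ d :> R by rewrite !exprS; ring.
have e5 : (0 : R) <= 5 ^+ d.+1 * M by rewrite mulr_ge0 ?exprn_ge0.
have -> : 5 ^+ d.+1 * ((1 + 4 * 2 ^+ d) * M) = (1 + 4 * 2 ^+ d) * (5 ^+ d.+1 * M).
  by ring.
rewrite [_ ^+ d.+2]exprS -mulrA.
move: (5 ^+ d.+1 * M) (2 ^+ d) e5 e1 => B e B0 e1 AB.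
(* With e = 2^d >= 1 one has 1 + 4e <= 5 (2e - 1), with equality at e = 1; this dictates the base
   5. *)
by rewrite -(ler_pM2r (_ : 0 < 2 * e - 1)); [nra|lra].
Qed.

End CoefficientBound.

(** * Coordinate averages and low-degree functions on a finite product space *)

Section ProductSpace.
Variables (R : rcfType) (I X : finType).
Hypothesis X_gt0 : (0 < #|X|)%N.

Notation cube := {ffun I -> X}.
Implicit Types (f g h : cube -> R) (z w : cube) (s : seq I).

Let Xneq0 : #|X|%:R != 0 :> R.
Proof. by rewrite pnatr_eq0 -lt0n. Qed.

Definition upd z i x : cube := [ffun j => if j == i then x else z j].

Definition avg i f : cube -> R := fun z => (\sum_x f (upd z i x)) / #|X|%:R.

Definition dif i f : cube -> R := fun z => f z - avg i f z.

Definition mean f : R := (\sum_z f z) / #|cube|%:R.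

Definition junta_on (S : {set I}) (Y : Type) (f : cube -> Y) :=
  forall z w, (forall i, i \in S -> z i = w i) -> f z = f w.

(** Degree is expressed through juntas rather than monomials, so that it makes sense for real-valued
    functions on any finite alphabet and passes to averages, differences and restrictions. *)
Definition low_degree (d : nat) f :=
  exists (J : finType) (S : J -> {set I}) (u : J -> cube -> R),
    [/\ forall j, (#|S j| <= d)%N, forall j, junta_on (S j) (u j) &
        forall z, f z = \sum_j u j z].

Lemma updd z i x y : upd (upd z i x) i y = upd z i y.
Proof. by apply/ffunP => j; rewrite !ffunE; case: eqP. Qed.

Lemma upd_id z i : upd z i (z i) = z.
Proof. by apply/ffunP => j; rewrite !ffunE; case: eqP => [->|]. Qed.

Lemma updE z i x : upd z i x i = x.
Proof. by rewrite ffunE eqxx. Qed.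

Lemma avg_upd i f z x : avg i f (upd z i x) = avg i f z.
Proof. by rewrite /avg; under eq_bigr do rewrite updd. Qed.

Lemma avg_const i f z : (forall x, f (upd z i x) = f z) -> avg i f z = f z.
Proof.
move=> fz; rewrite /avg; under eq_bigr do rewrite fz.
by rewrite sumr_const -[X in X / _]mulr_natr mulfK.
Qed.

Lemma avg_idem i f z : avg i (avg i f) z = avg i f z.
Proof. by rewrite avg_const// => x; rewrite avg_upd. Qed.

Lemma avgZ i a f z : avg i (fun w => a * f w) z = a * avg i f z.
Proof. by rewrite /avg -mulr_sumr mulrA. Qed.

Lemma avgB i f g z : avg i (fun w => f w - g w) z = avg i f z - avg i g z.
Proof. by rewrite /avg sumrB mulrBl. Qed.

Lemma avg_sum i (J : finType) (u : J -> cube -> R) z :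
  avg i (fun w => \sum_j u j w) z = \sum_j avg i (u j) z.
Proof. by rewrite /avg exchange_big mulr_suml. Qed.

Lemma dif_sum i (J : finType) (u : J -> cube -> R) z :
  dif i (fun w => \sum_j u j w) z = \sum_j dif i (u j) z.
Proof. by rewrite /dif avg_sum sumrB. Qed.

Lemma avg_dif i f z : avg i (dif i f) z = 0.
Proof. by rewrite avgB avg_idem subrr. Qed.

Lemma le_avg i f g z : (forall w, f w <= g w) -> avg i f z <= avg i g z.
Proof. by move=> fg; rewrite ler_pM2r ?invr_gt0 ?ltr0n// ler_sum. Qed.

Lemma junta_avg (S : {set I}) i f : junta_on S f -> junta_on (S :\ i) (avg i f).
Proof.
move=> fS z w zw; rewrite /avg; congr (_ / _); apply: eq_bigr => x _.
apply: fS => j jS; rewrite !ffunE; case: eqP => // /eqP ji.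
by apply: zw; rewrite !inE ji.
Qed.

Lemma sub_junta (S S' : {set I}) Y (f : cube -> Y) :
  S \subset S' -> junta_on S f -> junta_on S' f.
Proof. by move=> /fintype.subsetP SS' fS z w zw; apply: fS => i /SS'/zw. Qed.

Lemma junta_dif (S : {set I}) i f : junta_on S f -> junta_on S (dif i f).
Proof.
move=> fS z w zw; rewrite /dif (fS z w zw); congr (_ - _).
by apply: (sub_junta (subsetDl S [set i]) (junta_avg fS)).
Qed.

Lemma dif_eq0 (S : {set I}) i f z : junta_on S f -> i \notin S -> dif i f z = 0.
Proof.
move=> fS iS; rewrite /dif avg_const ?subrr// => x; apply: fS => j jS.
by rewrite ffunE; case: eqP => // ji; rewrite -ji jS in iS.
Qed.

Lemma low_degree_avg d i f : low_degree d f -> low_degree d (avg i f).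
Proof.
move=> [J [S [u [Sd uS fE]]]]; exists J, S, (fun j => avg i (u j)); split=> //.
  by move=> j; apply: sub_junta (junta_avg (uS j)); exact: subsetDl.
by move=> z; rewrite -avg_sum; congr avg; exact/funext.
Qed.

Lemma low_degree_dif d i f : low_degree d f -> low_degree d (dif i f).
Proof.
move=> [J [S [u [Sd uS fE]]]]; exists J, S, (fun j => dif i (u j)); split=> //.
  by move=> j; exact: junta_dif.
by move=> z; rewrite -dif_sum; congr dif; exact/funext.
Qed.

(** The degree drops by one: summands not depending on coordinate i are killed by [dif i], and the
    others lose that coordinate once it is frozen at x. *)
Lemma low_degree_dif_upd d i x f : low_degree d f ->
  low_degree d.-1 (fun z => dif i f (upd z i x)).
Proof.
move=> [J [S [u [Sd uS fE]]]].
pose S' j := if i \in S j then S j :\ i else finset.set0.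
exists J, S', (fun j z => dif i (u j) (upd z i x)); split.
- move=> j; rewrite /S'; case: ifPn => iS; last by rewrite cards0.
  by move: (Sd j); rewrite (cardsD1 i (S j)) iS; case: d {fE Sd}.
- move=> j z w; rewrite /S'; case: ifPn => iS zw.
    apply: (junta_dif i (uS j)) => k kS; rewrite !ffunE.
    by case: eqP => // /eqP ki; apply: zw; rewrite !inE ki.
  by rewrite !(dif_eq0 _ (uS j)).
- by move=> z; rewrite -dif_sum; congr dif; exact/funext.
Qed.

Lemma low_degree0_dif i f z : low_degree 0 f -> dif i f z = 0.
Proof.
move=> [J [S [u [Sd uS fE]]]].
have -> : f = fun z => \sum_j u j z by exact/funext.
rewrite dif_sum big1// => j _; apply: dif_eq0 (uS j) _.
by move: (Sd j); rewrite leqn0 cards_eq0 => /eqP ->; rewrite inE.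
Qed.

(** * The product of the operators 1 - t D_i as a polynomial in t *)

Fixpoint mix (t : R) s f : cube -> R :=
  if s is i :: s' then mix t s' (fun z => f z - t * dif i f z) else f.

(** The coefficient of t^k in [mix t s f]: up to the sign (-1)^k, the sum of the k-fold products of
    operators D_i, applied to f, over all choices of k positions in s. *)
Fixpoint mix_coef s (k : nat) f : cube -> R :=
  match s, k with
  | [::], 0%N => f
  | [::], _.+1 => fun=> 0
  | i :: s', 0%N => mix_coef s' 0 f
  | i :: s', k'.+1 => fun z => mix_coef s' k f z - mix_coef s' k' (dif i f) z
  end.

Lemma mixB t s f a g z :
  mix t s (fun w => f w - a * g w) z = mix t s f z - a * mix t s g z.
Proof.
elim: s f g => //= i s IHs f g; rewrite -IHs; congr (mix _ _ _ _).
by apply/funext => w; rewrite /dif avgB avgZ; ring.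
Qed.

Lemma mix_bound t s f (M : R) : 0 <= t <= 1 -> (forall z, `|f z| <= M) ->
  forall z, `|mix t s f z| <= M.
Proof.
move=> /andP[t0 t1]; elim: s f => //= i s IHs f fM z.
apply: IHs => w; rewrite ler_norml.
have /andP[a1 a2] : - M <= avg i f w <= M.
  have -> : M = avg i (fun=> M) w by rewrite avg_const.
  rewrite -[- avg _ _ _]mulN1r -avgZ; apply/andP; split; apply: le_avg => v.
    by rewrite mulN1r; move: (fM v); rewrite ler_norml => /andP[].
  by move: (fM v); rewrite ler_norml => /andP[].
move: (fM w); rewrite ler_norml /dif => /andP[f1 f2].
have -> : f w - t * (f w - avg i f w) = (1 - t) * f w + t * avg i f w by ring.
by apply/andP; split; nra.
Qed.

Lemma mix_coef_gt s k f z : (size s < k)%N -> mix_coef s k f z = 0.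
Proof.
elim: s k f => [|i s IHs] [|k]//= f sk.
by rewrite !IHs ?subrr// ltnW.
Qed.

Lemma mixE t s f z :
  mix t s f z = \sum_(k < (size s).+1) mix_coef s k f z * t ^+ k.
Proof.
elim: s f => [|i s IHs] f /=; first by rewrite big_ord1 mulr1.
rewrite mixB !IHs [RHS]big_ord_recl [X in X - _]big_ord_recl /= -addrA.
congr (_ + _); rewrite mulr_sumr.
have -> : \sum_(k < size s) mix_coef s (bump 0 k) f z * t ^+ bump 0 k =
    \sum_(k < (size s).+1) mix_coef s k.+1 f z * t ^+ k.+1.
  by rewrite [RHS]big_ord_recr /= mix_coef_gt// mul0r addr0.
by rewrite -sumrB; apply: eq_bigr => k _; rewrite /bump /= exprS; ring.
Qed.

Lemma mix_coef0 s f : mix_coef s 0 f = f.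
Proof. by elim: s. Qed.

Lemma mix_coef1 s f z : mix_coef s 1 f z = - \sum_(i <- s) dif i f z.
Proof.
elim: s => [|i s IHs] /=; first by rewrite big_nil oppr0.
by rewrite IHs mix_coef0 big_cons; ring.
Qed.

Lemma mix_coef_sum s k (J : finType) (u : J -> cube -> R) z :
  mix_coef s k (fun w => \sum_j u j w) z = \sum_j mix_coef s k (u j) z.
Proof.
elim: s k u => [|i s IHs] [|k] u //=; first by rewrite big1.
rewrite IHs sumrB; congr (_ - _); rewrite -IHs; congr mix_coef.
by apply/funext => w; rewrite dif_sum.
Qed.

(** A product of k operators D_i kills f as soon as one i lies outside S, so a surviving term needs
    k entries of s inside S. *)
Lemma mix_coef_junta (S : {set I}) s k f z : junta_on S f ->
  (count [in S] s < k)%N -> mix_coef s k f z = 0.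
Proof.
have mc0 : forall s k, mix_coef s k (fun=> 0) = fun=> 0.
  elim=> [|i s' IHs] [|k'] //=; apply/funext => w.
  have -> : dif i (fun=> 0) = fun=> 0.
    by apply/funext => v; rewrite /dif avg_const ?subrr.
  by rewrite !IHs subrr.
elim: s k f => [|i s IHs] [|k]//= f fS ck.
have [iS|iS] := boolP (i \in S).
  rewrite iS add1n in ck.
  by rewrite !IHs ?subrr//; [exact: junta_dif|exact: ltnW].
rewrite (negPf iS) add0n in ck; rewrite IHs//.
have -> : dif i f = fun=> 0 by apply/funext => w; exact: dif_eq0 iS.
by rewrite mc0 subrr.
Qed.

Lemma mix_coef_low_degree d s k f z : uniq s -> low_degree d f -> (d < k)%N ->
  mix_coef s k f z = 0.
Proof.
move=> s_uniq [J [S [u [Sd uS fE]]]] dk.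
have -> : f = fun z => \sum_j u j z by exact/funext.
rewrite mix_coef_sum big1// => j _; apply: mix_coef_junta (uS j) _.
apply: leq_ltn_trans dk; apply: leq_trans (Sd j).
rewrite -size_filter -(card_uniqP (filter_uniq _ s_uniq)).
by apply/subset_leq_card/fintype.subsetP => i; rewrite mem_filter => /andP[].
Qed.

Lemma sum_dif_bound d f (M : R) s z : uniq s -> low_degree d f ->
  (forall z, `|f z| <= M) -> `|\sum_(i <- s) dif i f z| <= 5 ^+ d * M.
Proof.
move=> s_uniq fd fM; rewrite -normrN -mix_coef1.
have M0 : 0 <= M by apply: le_trans (normr_ge0 _) (fM z).
(* The empty sequence is treated apart because [linear_coef_bound] expects at least two
   coefficients. *)
case: s s_uniq => [_|i s s_uniq]; first by rewrite /= normr0 mulr_ge0 ?exprn_ge0.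
apply: (@linear_coef_bound _ _ (size s) (fun k => mix_coef (i :: s) k f z)).
  by move=> k; exact: mix_coef_low_degree.
by move=> t t01; have := mix_bound (i :: s) t01 fM z; rewrite mixE.
Qed.

(** At the fixed point z the coordinates are split by the sign of [dif i f z]; on each half the
    absolute values add up to the absolute value of a signed sum, whence the factor 2. *)
Lemma sum_norm_dif_bound d f (M : R) z : low_degree d f ->
  (forall z, `|f z| <= M) -> \sum_i `|dif i f z| <= 2 * 5 ^+ d * M.
Proof.
move=> fd fM.
rewrite (bigID (fun i => 0 <= dif i f z)) /= -mulrA mulr_natl mulr2n.
have bnd (P : pred I) : `|\sum_(i | P i) dif i f z| <= 5 ^+ d * M.
  by rewrite -big_filter; apply: sum_dif_bound;
    rewrite ?filter_uniq ?index_enum_uniq.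
apply: lerD.
  rewrite (eq_bigr (fun i => dif i f z)) => [|i i0]; last by rewrite ger0_norm.
  exact: le_trans (ler_norm _) (bnd _).
rewrite (eq_bigr (fun i => - dif i f z)) => [|i i0]; last first.
  by rewrite ltr0_norm// ltNge.
by rewrite sumrN; apply: le_trans (ler_norm _) _; rewrite normrN bnd.
Qed.

(** * Means over the cube and orthogonality *)

Lemma cube_gt0 : 0 < #|{: cube}|%:R :> R.
Proof. by rewrite ltr0n card_ffun expn_gt0 X_gt0. Qed.

Lemma mean_const f c : (forall z, f z = c) -> mean f = c.
Proof.
move=> fc; rewrite /mean (eq_bigr (fun=> c)) => [|z _]; last exact: fc.
by rewrite sumr_const -[X in X / _]mulr_natr mulfK// gt_eqF ?cube_gt0.
Qed.

Lemma meanD f g : mean (fun z => f z + g z) = mean f + mean g.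
Proof. by rewrite /mean big_split mulrDl. Qed.

Lemma meanZ a f : mean (fun z => a * f z) = a * mean f.
Proof. by rewrite /mean -mulr_sumr mulrA. Qed.

Lemma meanZr a f : mean (fun z => f z * a) = mean f * a.
Proof. by rewrite /mean -mulr_suml mulrAC. Qed.

Lemma mean_sum (J : Type) (r : seq J) (P : pred J) (u : J -> cube -> R) :
  mean (fun z => \sum_(j <- r | P j) u j z) = \sum_(j <- r | P j) mean (u j).
Proof. by rewrite /mean exchange_big mulr_suml. Qed.

Lemma le_mean f g : (forall z, f z <= g z) -> mean f <= mean g.
Proof. by move=> fg; rewrite ler_pM2r ?invr_gt0 ?cube_gt0// ler_sum. Qed.

Lemma mean_ge0 f : (forall z, 0 <= f z) -> 0 <= mean f.
Proof. by move=> f0; rewrite mulr_ge0 ?invr_ge0 ?ler0n// sumr_ge0. Qed.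

Lemma eq_mean f g : f =1 g -> mean f = mean g.
Proof. by move=> fg; congr mean; exact/funext. Qed.

(** The involution [swap] exchanges the i-th coordinate of z with the fresh value x, which turns the
    double sum into one whose terms no longer depend on x. *)
Lemma mean_avg i f : mean (avg i f) = mean f.
Proof.
rewrite /mean; congr (_ / _); rewrite /avg -mulr_suml.
pose swap (p : cube * X) := (upd p.1 i p.2, p.1 i).
have swapK : involutive swap.
  by case=> z x; rewrite /swap /= updd upd_id updE.
rewrite pair_bigA /= (reindex_inj (inv_inj swapK)) /=.
under eq_bigr do rewrite updd upd_id.
rewrite -(pair_bigA _ (fun z x => f z)) /=.
under eq_bigr do rewrite sumr_const -mulr_natr.
by rewrite -mulr_suml mulfK.
Qed.

Lemma mean_upd i f : mean f = (\sum_x mean (fun z => f (upd z i x))) / #|X|%:R.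
Proof.
rewrite -(mean_avg i) -mean_sum mulrC -meanZ; apply: eq_mean => z.
by rewrite mulrC.
Qed.

(** The hypothesis is a way to say that g ignores coordinate i. Then g comes out of the average over
    that coordinate, and E_i D_i h = 0. It is applied to an average and to the cube of an
    average. *)
Lemma mean_avg_dif i f g h : (forall z, g z = avg i f z) ->
  mean (fun z => g z * dif i h z) = 0.
Proof.
move=> gE; rewrite -(mean_avg i) (@mean_const _ 0)// => z.
rewrite -[RHS](mulr0 (g z)) -(avg_dif i h z) -avgZ /avg; congr (_ / _).
by apply: eq_bigr => x _; rewrite !gE avg_upd.
Qed.

Lemma mean_sqr_split i f :
  mean (fun z => f z ^+ 2) =
  mean (fun z => avg i f z ^+ 2) + mean (fun z => dif i f z ^+ 2).
Proof.
have E0 := @mean_avg_dif i f _ f (fun=> erefl).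
rewrite -[RHS]addr0 -[X in _ + X](mulr0 2) -E0 -meanZ -!meanD.
by apply: eq_mean => z; rewrite /dif; ring.
Qed.

Lemma mean_Cauchy_Schwarz f g (a b : R) : 0 <= a -> 0 <= b ->
  mean (fun z => f z ^+ 2) <= a ^+ 2 -> mean (fun z => g z ^+ 2) <= b ^+ 2 ->
  mean (fun z => f z * g z) <= a * b.
Proof.
move=> a0 b0 fa gb.
have [ab0|ab0] := leP (mean (fun z => f z * g z)) 0.
  by apply: le_trans ab0 _; rewrite mulr_ge0.
rewrite -(ler_pXn2r (_ : 0 < 2)%N) ?nnegrE ?(ltW ab0) ?mulr_ge0//.
apply: le_trans (_ : _ <= mean (fun z => f z ^+ 2) * mean (fun z => g z ^+ 2)) _.
  rewrite -subr_ge0.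
  (* Lagrange's identity: the defect in Cauchy-Schwarz is half a double mean of squares. *)
  have -> : mean (fun z => f z ^+ 2) * mean (fun z => g z ^+ 2)
      - mean (fun z => f z * g z) ^+ 2
    = mean (fun z => mean (fun w => (f z * g w - f w * g z) ^+ 2)) / 2.
    have -> : (fun z => mean (fun w => (f z * g w - f w * g z) ^+ 2)) = (fun z =>
        f z ^+ 2 * mean (fun w => g w ^+ 2) + (g z ^+ 2 * mean (fun w => f w ^+ 2)
         + (f z * g z) * (- 2 * mean (fun w => f w * g w)))).
      by apply/funext => z; rewrite -!meanZ -!meanD; apply: eq_mean => w; ring.
    by rewrite !meanD !meanZr; field.
  by rewrite mulr_ge0 ?invr_ge0// mean_ge0// => z; rewrite mean_ge0// => w;
    rewrite sqr_ge0.
by rewrite exprMn ler_pM// mean_ge0// => z; rewrite sqr_ge0.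
Qed.

(** * Hypercontractivity, and comparison of the L2 and L1 norms *)

Lemma sum_sqr_le (J : finType) (m : J -> R) : (forall j, 0 <= m j) ->
  \sum_j m j ^+ 2 <= (\sum_j m j) ^+ 2.
Proof.
move=> m0; rewrite [leRHS]expr2 mulr_suml ler_sum// => j _.
by rewrite expr2 ler_wpM2l// (bigD1 j)//= lerDl sumr_ge0.
Qed.

Let K : R := #|X|%:R.

Let K_ge1 : 1 <= K.
Proof. by rewrite ler1n. Qed.

(** Bonami's argument, by induction on a list s of coordinates that determine f. Write f = g + h
    with g = E_i f and h = D_i f: g depends on fewer coordinates, and each restriction of h to a
    value of coordinate i also has smaller degree. The spare factor 4K gained from that degree drop
    pays for the cross terms. *)
Lemma hypercontractivity s d f : low_degree d f ->
  (forall z w, {in s, z =1 w} -> f z = f w) ->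
  mean (fun z => (f z ^+ 2) ^+ 2) <= ((4 * K) ^+ d * mean (fun z => f z ^+ 2)) ^+ 2.
Proof.
elim: s d f => [|i s IHs] d f fd fs.
  have [x0 _] := card_gt0P X_gt0; pose z0 : cube := [ffun=> x0].
  have fz z : f z = f z0 by exact: fs.
  rewrite (@mean_const _ ((f z0 ^+ 2) ^+ 2)) => [|z]; last by rewrite fz.
  rewrite (@mean_const _ (f z0 ^+ 2)) => [|z]; last by rewrite fz.
  rewrite [leRHS]exprMn ler_peMl ?sqr_ge0//.
  by rewrite -exprM exprn_ege1//; move: K_ge1; lra.
have avgs z w : {in s, z =1 w} -> avg i f z = avg i f w.
  move=> zw; congr (_ / _); apply: eq_bigr => x _; apply: fs => j.
  by rewrite inE !ffunE; case: eqP => //= _ /zw.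
case: d fd => [|d] fd.
  (* In degree 0 all D_i f vanish, so f ignores coordinate i and the induction hypothesis applies to
     f itself. *)
  have fE : f = avg i f.
    by apply/funext => z; apply/eqP; rewrite -subr_eq0; apply/eqP/low_degree0_dif.
  by apply: IHs => // z w; rewrite fE; exact: avgs.
set g := avg i f in avgs; pose h := dif i f.
have gi z x : g (upd z i x) = g z by exact: avg_upd.
set Q := (4 * K) ^+ d.
have K4 : 0 <= 4 * K by move: K_ge1; lra.
have Q0 : 0 <= Q by rewrite exprn_ge0.
have KQ0 : 0 <= (4 * K) ^+ d.+1 by rewrite exprn_ge0.
pose mg := mean (fun z => g z ^+ 2); pose mh := mean (fun z => h z ^+ 2).
pose m x := mean (fun z => h (upd z i x) ^+ 2).
have sqr_mean_ge0 u : 0 <= mean (fun z => u z ^+ 2).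
  by apply: mean_ge0 => z; exact: sqr_ge0.
have mg0 : 0 <= mg := sqr_mean_ge0 _.
have mh0 : 0 <= mh := sqr_mean_ge0 _.
have m0 x : 0 <= m x := sqr_mean_ge0 _.
have K0 : 0 < K by rewrite ltr0n.
have mhE : mh = (\sum_x m x) / K by rewrite /mh (mean_upd i).
have hyp_g : mean (fun z => (g z ^+ 2) ^+ 2) <= ((4 * K) ^+ d.+1 * mg) ^+ 2.
  by apply: IHs => //; exact: low_degree_avg.
have hyp_h x : mean (fun z => (h (upd z i x) ^+ 2) ^+ 2) <= (Q * m x) ^+ 2.
  apply: (IHs _ (fun z => h (upd z i x))) => [|z w zw].
    exact: (@low_degree_dif_upd d.+1).
  rewrite /h /dif -/g !gi (avgs _ _ zw); congr (_ - _); apply: fs => j.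
  by rewrite inE !ffunE; case: eqP => //= _ /zw.
have hyp_gh : mean (fun z => g z ^+ 2 * h z ^+ 2) <= ((4 * K) ^+ d.+1 * mg) * (Q * mh).
  rewrite (mean_upd i) mhE [Q * _]mulrA [_ * (_ / K)]mulrA.
  rewrite ler_pM2r ?invr_gt0// !mulr_sumr ler_sum// => x _.
  under eq_mean do rewrite gi.
  by apply: mean_Cauchy_Schwarz => //; exact: mulr_ge0.
(* The K restrictions of h have mean squares m x with sum K mh; bounding the sum of their squares by
   the square of their sum costs one factor K. *)
have hyp_hh : mean (fun z => (h z ^+ 2) ^+ 2) <= K * (Q * mh) ^+ 2.
  rewrite (mean_upd i); apply: le_trans (_ : (\sum_x (Q * m x) ^+ 2) / K <= _).
    by rewrite ler_pM2r ?invr_gt0// ler_sum.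
  apply: le_trans (_ : (\sum_x (Q * m x)) ^+ 2 / K <= _).
    by rewrite ler_pM2r ?invr_gt0// sum_sqr_le// => x; rewrite mulr_ge0.
  by rewrite -mulr_sumr mhE le_eqVlt; apply/orP; left; apply/eqP; field;
    rewrite gt_eqF.
have fE z : f z = g z + h z by rewrite /h /dif -/g; ring.
rewrite (mean_sqr_split i f) -/g -/h -/mg -/mh.
have E0 : mean (fun z => g z ^+ 3 * h z) = 0.
  by apply: (@mean_avg_dif i (fun z => g z ^+ 3)) => z; rewrite avg_const// => x;
    rewrite gi.
(* In the expansion of (g + h)^4 the term 4 g h^3 is absorbed into g^2 h^2 and h^4, with error 2 (h
   (g - h))^2 >= 0; the term 4 g^3 h has mean zero. *)
apply: le_trans (_ : mean (fun z => (g z ^+ 2) ^+ 2 + (8 * (g z ^+ 2 * h z ^+ 2)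
   + (3 * (h z ^+ 2) ^+ 2 + 4 * (g z ^+ 3 * h z)))) <= _).
  apply: le_mean => z; rewrite fE -subr_ge0.
  have -> : forall a b : R, (a ^+ 2) ^+ 2 + (8 * (a ^+ 2 * b ^+ 2)
    + (3 * (b ^+ 2) ^+ 2 + 4 * (a ^+ 3 * b))) - ((a + b) ^+ 2) ^+ 2
    = 2 * (b * (a - b)) ^+ 2 by move=> a b; ring.
  by rewrite mulr_ge0 ?sqr_ge0.
rewrite !meanD !meanZ E0 mulr0 addr0.
have {}hyp_g : mean (fun z => (g z ^+ 2) ^+ 2) <= (4 * K * (Q * mg)) ^+ 2.
  by apply: le_trans hyp_g _; rewrite [(4 * K) ^+ d.+1]exprS -(mulrA (4 * K)).
have {}hyp_gh : mean (fun z => g z ^+ 2 * h z ^+ 2) <= 4 * K * (Q * mg) * (Q * mh).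
  by apply: le_trans hyp_gh _; rewrite [(4 * K) ^+ d.+1]exprS -(mulrA (4 * K)).
have -> : (4 * K) ^+ d.+1 * (mg + mh) = 4 * K * (Q * mg + Q * mh).
  by rewrite [(4 * K) ^+ d.+1]exprS -(mulrA (4 * K)) mulrDr.
have : 0 <= Q * mg by rewrite mulr_ge0.
have : 0 <= Q * mh by rewrite mulr_ge0.
move: (Q * mg) (Q * mh) hyp_g hyp_gh hyp_hh => P S hg hgh hhh S0 P0.
have : 0 <= K * (K - 1) * (P * S).
  by rewrite !mulr_ge0 ?subr_ge0// ltW.
have : 0 <= K * (K - 1) * S ^+ 2 by rewrite !mulr_ge0 ?sqr_ge0 ?subr_ge0 ?K_ge1// ltW.
have : 0 <= K ^+ 2 * S ^+ 2 by rewrite mulr_ge0 ?sqr_ge0.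
nra.
Qed.

(** Truncation at height 2s with s = Q N: smaller values of |f| are controlled by the L1 norm,
    larger ones by the fourth moment. Taking means in [pt] gives 4 Q^2 N^4 <= 8 Q^3 N^3 e + Q^2 N^4,
    so 3 N <= 8 Q e, and 8/3 is rounded up to 3. *)
Lemma L2_le_L1 d f : low_degree d f ->
  Num.sqrt (mean (fun z => f z ^+ 2)) <= 3 * (4 * K) ^+ d * mean (fun z => `|f z|).
Proof.
move=> fd; set m := mean (fun z => f z ^+ 2); set N := Num.sqrt m.
have m0 : 0 <= m by apply: mean_ge0 => z; exact: sqr_ge0.
have mE : m = N ^+ 2 by rewrite sqr_sqrtr.
set e := mean _.
have e0 : 0 <= e by apply: mean_ge0 => z; exact: normr_ge0.
have K0 : 0 < 4 * K by move: K_ge1; lra.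
set Q := (4 * K) ^+ d; have Q0 : 0 < Q by rewrite exprn_gt0.
have [N0|N0] := leP N 0; first by apply: le_trans N0 _;
  rewrite mulr_ge0// mulr_ge0// ltW.
have hyp : mean (fun z => (f z ^+ 2) ^+ 2) <= (Q * m) ^+ 2.
  apply: (@hypercontractivity (enum I)) => // z w zw; congr f.
  by apply/ffunP => i; apply: zw; rewrite mem_enum.
pose s := Q * N; have s0 : 0 < s by rewrite mulr_gt0.
have pt z : 4 * s ^+ 2 * f z ^+ 2 <= 8 * s ^+ 3 * `|f z| + (f z ^+ 2) ^+ 2.
  rewrite -[f z ^+ 2]real_normK ?num_real//; set u := `|f z|.
  have u0 : 0 <= u by exact: normr_ge0.
  have [us|us] := leP u (2 * s).
    apply: le_trans (_ : 8 * s ^+ 3 * u <= _); last by rewrite lerDl sqr_ge0.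
    have -> : 4 * s ^+ 2 * u ^+ 2 = 4 * s ^+ 2 * u * u by ring.
    have -> : 8 * s ^+ 3 * u = 4 * s ^+ 2 * u * (2 * s) by ring.
    by rewrite ler_wpM2l// mulr_ge0// mulr_ge0// sqr_ge0.
  apply: le_trans (_ : (u ^+ 2) ^+ 2 <= _); last first.
    by rewrite lerDr mulr_ge0// mulr_ge0// exprn_ge0// ltW.
  rewrite [leRHS]expr2 ler_wpM2r ?sqr_ge0//.
  have -> : 4 * s ^+ 2 = (2 * s) ^+ 2 by ring.
  by rewrite ler_pXn2r// ?nnegrE ?(ltW us)// mulr_ge0// ltW.
have := le_mean pt; rewrite meanD !meanZ -/e -/m => le1.
have {le1 hyp} : 4 * s ^+ 2 * m <= 8 * s ^+ 3 * e + (Q * m) ^+ 2 by lra.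
rewrite mE /s => le2.
have {le2} : Q ^+ 2 * N ^+ 3 * (3 * N) <= Q ^+ 2 * N ^+ 3 * (8 * Q * e).
  rewrite -subr_ge0 in le2; rewrite -subr_ge0.
  by apply: le_trans le2 _; rewrite le_eqVlt; apply/orP; left; apply/eqP; ring.
rewrite ler_pM2l ?mulr_gt0 ?exprn_gt0// => le3.
have : 0 <= Q * e by rewrite mulr_ge0// ltW.
by rewrite -mulrA in le3; rewrite -mulrA; lra.
Qed.

(** * Total influence and approximation by averaging out coordinates *)

Lemma sum_influence_bound d f : low_degree d f -> (forall z, `|f z| <= 1) ->
  \sum_i Num.sqrt (mean (fun z => dif i f z ^+ 2)) <= 6 * (20 * K) ^+ d.
Proof.
move=> fd f1.
apply: le_trans (_ : \sum_i 3 * (4 * K) ^+ d * mean (fun z => `|dif i f z|) <= _).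
  by apply: ler_sum => i _; apply: L2_le_L1; exact: low_degree_dif.
rewrite -mulr_sumr -mean_sum.
have K0 : 0 <= 4 * K by move: K_ge1; lra.
have -> : 6 * (20 * K) ^+ d = 3 * (4 * K) ^+ d * (2 * 5 ^+ d * 1).
  have -> : 20 * K = 4 * K * 5 by ring.
  by rewrite exprMn; ring.
rewrite ler_wpM2l ?mulr_ge0 ?exprn_ge0//.
rewrite -[leRHS](@mean_const (fun=> 2 * 5 ^+ d * 1))//.
by apply: le_mean => z; exact: sum_norm_dif_bound.
Qed.

(** Averaging over one more coordinate i splits the new error orthogonally: its D_i part is D_i f,
    and its E_i part is the E_i average of the previous error, hence no larger than that error. *)
Lemma mean_sqr_avgs s f :
  mean (fun z => (f z - foldr avg f s z) ^+ 2) <=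
  \sum_(i <- s) mean (fun z => dif i f z ^+ 2).
Proof.
elim: s => [|i s IHs] /=.
  by rewrite big_nil (@mean_const _ 0)// => z; rewrite subrr expr0n.
rewrite big_cons (mean_sqr_split i) addrC; apply: lerD.
  have dE z : dif i (fun w => f w - avg i (foldr avg f s) w) z = dif i f z.
    by rewrite /dif avgB avg_idem; ring.
  by under eq_mean do rewrite dE.
apply: le_trans IHs; rewrite [leRHS](mean_sqr_split i).
rewrite (eq_mean (g := fun z => avg i (fun w => f w - foldr avg f s w) z ^+ 2)).
  by rewrite lerDl mean_ge0// => z; exact: sqr_ge0.
by move=> z; rewrite !avgB avg_idem.
Qed.

Lemma junta_avgs s f : junta_on [set i | i \notin s] (foldr avg f s).
Proof.
elim: s => [|i s IHs] /=.
  by move=> z w zw; congr f; apply/ffunP => i; apply: zw; rewrite inE.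
apply: sub_junta (junta_avg IHs); apply/fintype.subsetP => j.
by rewrite !inE negb_or.
Qed.

Lemma bounded_low_degree_junta d f (e : R) : low_degree d f ->
  (forall z, `|f z| <= 1) -> 0 < e ->
  exists (S : {set I}) g, [/\ junta_on S g,
    mean (fun z => (f z - g z) ^+ 2) <= e &
    #|S|%:R <= (6 * (20 * K) ^+ d) ^+ 2 / e].
Proof.
move=> fd f1 e0; set M := 6 * _ ^+ d.
have M0 : 0 < M by rewrite mulr_gt0 ?exprn_gt0//; move: K_ge1; lra.
pose N i := Num.sqrt (mean (fun z => dif i f z ^+ 2)).
have N0 i : 0 <= N i by exact: sqrtr_ge0.
have NM : \sum_i N i <= M by exact: sum_influence_bound.
pose S := [set i | e / M < N i].
have eM : 0 < e / M by rewrite divr_gt0.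
exists S, (foldr avg f (enum (~: S))); split.
- apply: sub_junta (@junta_avgs _ _); apply/fintype.subsetP => i.
  by rewrite inE mem_enum inE negbK.
- apply: le_trans (mean_sqr_avgs _ _) _; rewrite big_enum /=.
  apply: le_trans (_ : \sum_(i in ~: S) e / M * N i <= _).
    apply: ler_sum => i; rewrite !inE -leNgt => NieM.
    rewrite -[leLHS]sqr_sqrtr; last by apply: mean_ge0 => z; exact: sqr_ge0.
    by rewrite expr2 ler_wpM2r// N0.
  rewrite -mulr_sumr -[leRHS](divfK (lt0r_neq0 M0)) ler_wpM2l// ?(ltW eM)//.
  by apply: le_trans NM; rewrite [leRHS](bigID [in ~: S])/= lerDl sumr_ge0.
(* Markov's inequality: every i in S contributes more than e / M to a sum that is at most M. *)
- rewrite ler_pdivlMr// expr2 -[leLHS](divfK (lt0r_neq0 M0)) ler_pM2r//.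
  rewrite -mulrA; apply: le_trans NM; rewrite [leRHS](bigID [in S])/=.
  rewrite -[leLHS]addr0 lerD ?sumr_ge0// mulrC mulr_natr -sumr_const.
  by apply: ler_sum => i; rewrite inE => /ltW.
Qed.

End ProductSpace.

(** * Roots of unity, and the passage from complex to real functions *)

Section CyclicCube.
Import ComplexField.Normc.
Variables (R : realType) (K : nat).
Hypothesis K_gt0 : (0 < K)%N.

Notation X := (seq_sub (Omega R K)).
Notation w := (omega R K).

Lemma ReD (x y : R[i]) : complex.Re (x + y) = complex.Re x + complex.Re y.
Proof. by case: x y => [? ?] [? ?]. Qed.

Lemma ImD (x y : R[i]) : complex.Im (x + y) = complex.Im x + complex.Im y.
Proof. by case: x y => [? ?] [? ?]. Qed.

Lemma sqr_normcE (x : R[i]) : normc x ^+ 2 = complex.Re x ^+ 2 + complex.Im x ^+ 2.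
Proof. by case: x => a b; rewrite /normc sqr_sqrtr ?addr_ge0 ?sqr_ge0. Qed.

Lemma normc_ge0 (x : R[i]) : 0 <= normc x.
Proof. by case: x => a b; exact: sqrtr_ge0. Qed.

Lemma normr_Re_le (x : R[i]) : `|complex.Re x| <= normc x.
Proof.
rewrite -ler_sqr ?nnegrE ?normc_ge0// sqr_normcE real_normK ?num_real//.
by rewrite lerDl sqr_ge0.
Qed.

Lemma normr_Im_le (x : R[i]) : `|complex.Im x| <= normc x.
Proof.
rewrite -ler_sqr ?nnegrE ?normc_ge0// sqr_normcE real_normK ?num_real//.
by rewrite lerDr sqr_ge0.
Qed.

Lemma sqr_normcC (x : R[i]) : (normc x ^+ 2)%:C = x * x^*%C.
Proof. by case: x => a b; rewrite sqr_normcE /=; simpc; congr (_ +i* _);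
  ring. Qed.

Lemma omegaX (m : nat) :
  w ^+ m = cos (m%:R * (2 * pi / K%:R)) +i* sin (m%:R * (2 * pi / K%:R)).
Proof.
rewrite /omega; move: (2 * pi / K%:R) => t.
elim: m => [|m IHm]; first by rewrite mul0r cos0 sin0.
rewrite exprSr IHm -[m.+1%:R]natr1 mulrDl mul1r cosD sinD; simpc.
by congr (_ +i* _); ring.
Qed.

Lemma omegaXK : w ^+ K = 1.
Proof.
rewrite omegaX mulrC divfK ?pnatr_eq0 -?lt0n// mulr_natl cos2pi sin2pi.
by [].
Qed.

Lemma omega_neq0 : w != 0.
Proof. by apply/eqP => w0; move: omegaXK => /eqP;
  rewrite w0 expr0n gtn_eqF// eq_sym oner_eq0. Qed.

(** For 0 < m < K the angle x = m pi / K lies strictly between 0 and pi, so sin x > 0 and cos 2x = 1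
    - 2 sin^2 x < 1. *)
Lemma omegaX_eq1 m : (m < K)%N -> w ^+ m = 1 -> m = 0%N.
Proof.
move=> mK; rewrite omegaX => -[cos1 _]; apply/eqP; rewrite -leqn0 leqNgt.
apply/negP => m0; set x := m%:R * (pi / K%:R) : R.
have K0 : 0 < K%:R :> R by rewrite ltr0n.
have x0 : 0 < x by rewrite mulr_gt0 ?divr_gt0 ?pi_gt0 ?ltr0n.
have xpi : x < pi.
  by rewrite /x mulrCA gtr_pMr ?pi_gt0// ltr_pdivrMr// mul1r ltr_nat.
have sx : 0 < sin x by rewrite sin_gt0_pi// x0.
move: cos1; have -> : m%:R * (2 * pi / K%:R) = x *+ 2 by rewrite /x -mulr_natl;
  ring.
rewrite mulr2n cosD -!expr2 => h; have : 0 < sin x ^+ 2 by rewrite exprn_gt0.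
by have := cos2Dsin2 x; lra.
Qed.

Lemma normc_omega : normc w = 1.
Proof. by rewrite /normc /= cos2Dsin2 sqrtr1. Qed.

Lemma Omega_mull x : x \in Omega R K -> w * x \in Omega R K.
Proof.
move=> /mapP[j]; rewrite mem_iota add0n => /andP[_ jK] ->; rewrite -exprS.
move: jK; rewrite leq_eqVlt => /predU1P[->|jK].
  by rewrite omegaXK; apply/mapP; exists 0%N; rewrite ?mem_iota.
by apply/mapP; exists j.+1; rewrite ?mem_iota.
Qed.

Lemma normc_Omega (x : X) : normc (ssval x) = 1.
Proof.
case: x => x /= /mapP[j _ ->]; elim: j => [|j IHj]; first by rewrite expr0 normc1.
by rewrite exprS normcM IHj normc_omega mulr1.
Qed.

Lemma card_Omega_gt0 : (0 < #|{: X}|)%N.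
Proof.
have w0 : w ^+ 0 \in Omega R K by apply/mapP; exists 0%N; rewrite ?mem_iota.
by apply/card_gt0P; exists (SeqSub w0).
Qed.

Definition turn (x : X) : X := SeqSub (Omega_mull (valP x)).

Lemma turn_inj : injective turn.
Proof.
by move=> x y /(congr1 val) /= /(mulfI omega_neq0) xy; exact: val_inj.
Qed.

Lemma omegaX_inj a b : (a < K)%N -> (b < K)%N -> w ^+ a = w ^+ b -> a = b.
Proof.
wlog ab : a b / (a <= b)%N.
  move=> wlg aK bK wab; have [ab|/ltnW ba] := leqP a b; first exact: wlg.
  by apply/esym/wlg.
move=> aK bK wab; apply/eqP; rewrite eqn_leq ab -subn_eq0; apply/eqP/omegaX_eq1.
  exact: leq_ltn_trans (leq_subr _ _) bK.
apply: (mulIf (expf_neq0 a omega_neq0)).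
by rewrite -exprD subnK// mul1r.
Qed.

Lemma normc_eq1_mulJ (x : R[i]) : normc x = 1 -> x * x^*%C = 1.
Proof. by move=> x1; rewrite -sqr_normcC x1 expr1n. Qed.

Variable n : nat.
Implicit Types (a : multiindex K n -> R[i]) (alpha beta : multiindex K n).
Implicit Types (f g : cube R K n -> R[i]).

Definition support alpha : {set 'I_n} := [set i | (0 < alpha i)%N].

Lemma card_support alpha : (#|support alpha| <= mdegree alpha)%N.
Proof.
rewrite -sum1_card /mdegree big_mkcond leq_sum// => i _.
by rewrite inE; case: (alpha i : nat).
Qed.

Lemma junta_monomial alpha : junta_on (support alpha) (@monomial R K n alpha).
Proof.
move=> z z' zz'; apply: eq_bigr => i _.
have [a0|] := posnP (alpha i); first by rewrite a0 !expr0.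
by move=> a0; rewrite zz' ?inE.
Qed.

Lemma normc_monomial alpha z : normc (@monomial R K n alpha z) = 1.
Proof.
rewrite /monomial; elim/big_ind: _ => [|x y x1 y1|i _]; first exact: normc1.
  by rewrite normcM x1 y1 mulr1.
elim: (nat_of_ord _) => [|j IHj]; first by rewrite expr0 normc1.
by rewrite exprS normcM IHj normc_Omega mulr1.
Qed.

(** [phi] stands for the real or the imaginary part; additivity lets it act term by term on the
    expansion. *)
Lemma low_degree_expansion d a (phi : R[i] -> R) : {morph phi : x y / x + y} ->
  supported_le d a -> low_degree d (fun z => phi (expansion a z)).
Proof.
move=> phiD ad.
have phi0 : phi 0 = 0 by apply: (addrI (phi 0)); rewrite -phiD !addr0.
exists (multiindex K n).
(* Terms of degree above d are identically zero, so the empty set of coordinates serves for them. *)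
exists (fun alpha => if (mdegree alpha <= d)%N then support alpha else finset.set0).
exists (fun alpha z => phi (a alpha * monomial alpha z)); split.
- move=> alpha; case: ifP => [|_]; last by rewrite cards0.
  exact: leq_trans (card_support alpha).
- move=> alpha; case: ifPn => [_ z z' zz'|];
  first by rewrite (junta_monomial zz').
  by rewrite -ltnNge => /ad -> z z' _; rewrite !mul0r.
- by move=> z; rewrite (big_morph phi phiD phi0).
Qed.

Lemma normc_le_supnorm f z : normc (f z) <= supnorm f.
Proof.
apply: sup_upper_bound; last by exists z.
split; first by exists (normc (f z)), z.
exists (\sum_z' normc (f z')) => _ [z' _ <-].
by rewrite (bigD1 z')//= lerDl sumr_ge0// => z'' _; exact: normc_ge0.
Qed.

Lemma cube_inhabited : exists z : cube R K n, True.
Proof. by have [x _] := card_gt0P card_Omega_gt0; exists [ffun=> x]. Qed.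

Lemma supnorm_le f (M : R) : (forall z, normc (f z) <= M) -> supnorm f <= M.
Proof.
move=> fM; apply: ge_sup => [|_ [z _ <-]]; last exact: fM.
by have [z _] := cube_inhabited; exists (normc (f z)), z.
Qed.

Lemma supnorm_ge0 f : 0 <= supnorm f.
Proof.
by have [z _] := cube_inhabited;
  exact: le_trans (normc_ge0 _) (normc_le_supnorm f z).
Qed.

Lemma l2normE f : l2norm f = Num.sqrt (mean (fun z => normc (f z) ^+ 2)).
Proof. by []. Qed.

Lemma l2norm_le f (e : R) : 0 <= e ->
  mean (fun z => normc (f z) ^+ 2) <= e ^+ 2 -> l2norm f <= e.
Proof.
by move=> e0 fe; rewrite l2normE -[leRHS]ger0_norm// -sqrtr_sqr ler_wsqrtr.
Qed.

(** Real and imaginary parts are approximated separately, each with squared error eps^2 / 2, and the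
    two coordinate sets are united. The count is 2 (6 (20 x)^d)^2 / (eps^2 / 2) with x the
    cardinality of Omega_K. *)
Lemma degree_le_junta d f (eps : R) : degree_le d f -> supnorm f <= 1 -> 0 < eps ->
  exists (k : nat) (g : cube R K n -> R[i]),
    [/\ junta k g, l2norm (fun z => f z - g z) <= eps &
        k%:R <= 144 * (400 * #|{: X}|%:R ^+ 2) ^+ d / eps ^+ 2].
Proof.
move=> [a [fa ad]] f1 eps0.
have e0 : 0 < eps ^+ 2 / 2 by rewrite divr_gt0 ?exprn_gt0.
have fE : f = expansion a by exact/funext.
have [S1 [g1 [S1g1 fg1 S1e]]] := @bounded_low_degree_junta _ _ _ card_Omega_gt0 d
  (fun z => complex.Re (f z)) _ ltac:(rewrite fE;
    exact: low_degree_expansion ReD ad)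
  (fun z => le_trans (normr_Re_le _) (le_trans (normc_le_supnorm f z) f1)) e0.
have [S2 [g2 [S2g2 fg2 S2e]]] := @bounded_low_degree_junta _ _ _ card_Omega_gt0 d
  (fun z => complex.Im (f z)) _ ltac:(rewrite fE;
    exact: low_degree_expansion ImD ad)
  (fun z => le_trans (normr_Im_le _) (le_trans (normc_le_supnorm f z) f1)) e0.
exists #|S1 :|: S2|, (fun z => g1 z +i* g2 z); split.
- exists (S1 :|: S2) => // z z' zz'; congr (_ +i* _).
    by apply: S1g1 => i iS; apply: zz'; rewrite inE iS.
  by apply: S2g2 => i iS; apply: zz'; rewrite inE iS orbT.
- apply: l2norm_le; first exact: ltW.
  rewrite [leRHS](_ : _ = eps ^+ 2 / 2 + eps ^+ 2 / 2); last by field.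
  apply: le_trans (lerD fg1 fg2); rewrite -meanD le_eqVlt; apply/orP; left;
    apply/eqP.
  apply: eq_mean => z.
  by rewrite sqr_normcE; case: (f z).
- apply: le_trans (_ : #|S1|%:R + #|S2|%:R <= _).
    by rewrite -natrD ler_nat cardsU leq_subr.
  apply: le_trans (lerD S1e S2e) _; rewrite le_eqVlt; apply/orP; left; apply/eqP.
  have -> : 400 * #|{: X}|%:R ^+ 2 = (20 * #|{: X}|%:R) ^+ 2 :> R by ring.
  rewrite -exprM mulnC exprM.
  by field; rewrite gt_eqF.
Qed.

(** * Orthogonality of monomials and Parseval's identity *)

Definition rotate (i : 'I_n) (z : cube R K n) : cube R K n := upd z i (turn (z i)).

Lemma rotate_inj i : injective (rotate i).
Proof.
move=> z z' zz'; apply/ffunP => j.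
move/ffunP: zz' => /(_ j); rewrite !ffunE; case: eqP => [->|//].
exact: turn_inj.
Qed.

Lemma monomial_rotate alpha i z :
  monomial alpha (rotate i z) = w ^+ alpha i * monomial alpha z.
Proof.
rewrite /monomial (bigD1 i)//= [in RHS](bigD1 i)//= mulrA; congr (_ * _).
  by rewrite updE /= exprMn.
by apply: eq_bigr => j ji; rewrite ffunE (negPf ji).
Qed.

(** Rotating a coordinate where alpha and beta differ permutes the cube and multiplies the sum by a
    power of omega other than 1, so the sum vanishes. *)
Lemma monomial_orthogonal alpha beta : alpha != beta ->
  \sum_(z : cube R K n) monomial alpha z * (monomial beta z)^*%C = 0.
Proof.
move=> ab.
have [i abi] : exists i, alpha i != beta i.
  by apply/existsP; apply: contraNT ab; rewrite negb_exists => /forallP ab;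
    apply/eqP/ffunP => i; apply/eqP; rewrite -[_ == _]negbK ab.
set T := \sum_z _.
have TE : T = w ^+ alpha i * (w ^+ beta i)^*%C * T.
  rewrite {1}/T (reindex_inj (@rotate_inj i)) mulr_sumr; apply: eq_bigr => z _.
  by rewrite !monomial_rotate rmorphM /=; ring.
have /eqP : (1 - w ^+ alpha i * (w ^+ beta i)^*%C) * T = 0.
  by rewrite mulrBl mul1r -TE subrr.
rewrite mulf_eq0 => /orP[|/eqP//]; rewrite subr_eq0 => /eqP w1.
have wb : w ^+ beta i * (w ^+ beta i)^*%C = 1.
  apply: normc_eq1_mulJ; elim: (nat_of_ord _) => [|j IHj].
    by rewrite expr0 normc1.
  by rewrite exprS normcM IHj normc_omega mulr1.
case/negP: abi; apply/eqP/val_inj; apply: (omegaX_inj (ltn_ord _) (ltn_ord _)).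
have wb0 : (w ^+ beta i)^*%C != 0.
  by apply/eqP => w0; move: wb => /eqP; rewrite w0 mulr0 eq_sym oner_eq0.
by apply: (mulIf wb0); rewrite wb -w1.
Qed.

Lemma Parseval a :
  mean (fun z : cube R K n => normc (expansion a z) ^+ 2) =
  \sum_alpha normc (a alpha) ^+ 2.
Proof.
have N0 := cube_gt0 R 'I_n (card_Omega_gt0).
rewrite /mean; apply: (canLR (mulfK _)); first by rewrite gt_eqF.
(* The real identity is checked inside [R[i]], where a squared modulus is x times its conjugate. *)
apply: (@complexI R); rewrite !rmorphM !rmorph_sum /=.
under eq_bigr do rewrite sqr_normcC /expansion mulr_suml rmorph_sum.
rewrite exchange_big mulr_suml; apply: eq_bigr => alpha _.
under eq_bigr do rewrite mulr_sumr.
rewrite exchange_big (bigD1 alpha)//= [X in _ + X]big1 ?addr0 => [|beta ba];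
  last first.
  under eq_bigr do rewrite rmorphM mulrACA.
  by rewrite -mulr_sumr monomial_orthogonal ?mulr0// eq_sym.
under eq_bigr do rewrite rmorphM mulrACA -!sqr_normcC normc_monomial expr1n mulr1.
by rewrite sumr_const -[LHS]mulr_natr rmorph_nat.
Qed.

End CyclicCube.

(** * Thresholding with the Bohnenblust-Hille constant *)

Section BohnenblustHille.
Import ComplexField.Normc.
Variables (R : realType) (K : nat).
Hypothesis K_gt0 : (0 < K)%N.

(** The constant function 1 in one variable is the test function. *)
Lemma BHadmissible_ge1 d (C : R) : (0 < d)%N -> BHadmissible K d C -> 1 <= C.
Proof.
move=> d0 adm.
pose zero : multiindex K 1 := [ffun=> Ordinal K_gt0].
pose a (alpha : multiindex K 1) : R[i] := (alpha == zero)%:R.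
have ad : supported_le d a.
  move=> alpha; rewrite /a; case: eqP => // ->; rewrite /mdegree big1// => i _.
  by rewrite ffunE.
(* A nonzero exponent ensures that zero coefficients contribute 0, since [powR] gives 1 for 0 to the
   power 0. *)
have q0 : (2 * d)%:R / d.+1%:R != 0 :> R.
  by rewrite mulf_neq0 ?invr_eq0 ?pnatr_eq0 ?muln_eq0//= -lt0n.
have := adm 1%N a isT ad.
have -> : BHnorm d a = 1.
  rewrite /BHnorm (bigD1 zero)//= big1 => [|alpha /negPf a0].
    by rewrite /a eqxx normc1 powR1 addr0 powR1.
  by rewrite /a a0 normc0 powR0.
have s1 : supnorm (expansion (R := R) a) <= 1.
  apply: (supnorm_le K_gt0) => z;
    rewrite /expansion (bigD1 zero)//= big1 => [|alpha /negPf a0].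
    by rewrite /a eqxx mul1r addr0 normc_monomial.
  by rewrite /a a0 mul0r.
have s0 := supnorm_ge0 K_gt0 (expansion (R := R) a).
move=> h; rewrite leNgt; apply/negP => C1.
have [C0|C0] := leP C 0; nra.
Qed.

Lemma BH_ge1 d : (0 < d)%N -> (1 <= BH R K d)%E.
Proof.
by move=> d0; apply: le_ereal_inf_tmp => _ [C adm <-];
  rewrite lee_fin (BHadmissible_ge1 d0).
Qed.

Variable n : nat.
Implicit Types (a : multiindex K n -> R[i]) (alpha : multiindex K n).

Lemma BHnorm_le_BH d a : (0 < n)%N -> (0 < d)%N -> supported_le d a ->
  supnorm (expansion (R := R) a) <= 1 -> ((BHnorm d a)%:E <= BH R K d)%E.
Proof.
move=> n0 d0 ad a1; apply: le_ereal_inf_tmp => _ [C adm <-]; rewrite lee_fin.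
apply: le_trans (adm n a n0 ad) _; rewrite ler_piMr//.
exact: le_trans ler01 (BHadmissible_ge1 d0 adm).
Qed.

(** Passing to the (d+1)-th roots [y] and [beta] of the moduli of the coefficients and of b turns
    the exponent 2d/(d+1) into the integer power 2d. *)
Lemma BH_junta d a (b eps : R) : supported_le d a -> (0 < d)%N ->
  0 < b -> BHnorm d a <= b -> 0 < eps ->
  exists (k : nat) (g : cube R K n -> R[i]),
    [/\ junta k g, l2norm (fun z => expansion a z - g z) <= eps &
        k%:R <= d%:R * b ^+ (2 * d) / eps ^+ (2 * d)].
Proof.
move=> ad d0 b0 ab eps0.
have d1 : d.+1%:R != 0 :> R by rewrite pnatr_eq0.
have dr : d%:R != 0 :> R by rewrite pnatr_eq0 -lt0n.
pose root (x : R) := x `^ d.+1%:R^-1.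
have root_ge0 x : 0 <= root x by exact: powR_ge0.
have rootK x : 0 <= x -> root x ^+ d.+1 = x.
  by move=> x0; rewrite -powR_mulrn// -powRrM mulVf// powRr1.
have rootX x : x `^ ((2 * d)%:R / d.+1%:R) = root x ^+ (2 * d).
  by rewrite -powR_mulrn// -powRrM mulrC.
pose y alpha := root (normc (a alpha)).
pose beta := root b.
have beta0 : 0 < beta by exact: powR_gt0.
have ybeta : \sum_alpha y alpha ^+ (2 * d) <= beta ^+ (2 * d).
  have le0 : 0 <= \sum_alpha y alpha ^+ (2 * d) by apply: sumr_ge0 => *;
    rewrite exprn_ge0 ?root_ge0.
  rewrite -[leLHS]powRr1// -[X in _ `^ X](@mulVf _ ((2 * d)%:R / d.+1%:R));
    last first.
    by rewrite mulf_neq0 ?invr_eq0// natrM mulf_neq0.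
  rewrite powRrM invf_div -rootX ge0_ler_powR ?nnegrE ?powR_ge0 ?(ltW b0)//.
  by apply: le_trans ab; rewrite /BHnorm;
    under [X in _ <= X `^ _]eq_bigr do rewrite rootX.
(* The (d+1)-th root of the threshold eps^(d+1) / b^d for the coefficients. *)
pose gamma := eps / beta ^+ d.
have gamma0 : 0 < gamma by rewrite divr_gt0 ?exprn_gt0.
pose A := [set alpha | gamma < y alpha].
have A_supp alpha : alpha \in A -> (#|support alpha| <= d)%N.
  rewrite inE => yA; apply: leq_trans (card_support alpha) _.
  rewrite leqNgt; apply/negP => /ad a0; move: yA.
  by rewrite /y /root a0 normc0 powR0 ?invr_eq0// ltNge (ltW gamma0).
pose a' alpha := if alpha \in A then 0 else a alpha.
pose g z := \sum_(alpha in A) a alpha * monomial alpha z.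
pose S : {set 'I_n} := [set i | [exists alpha in A, i \in support alpha]].
exists #|S|, g; split.
- exists S => // z z' zz'; apply: eq_bigr => alpha aA; congr (_ * _).
  apply: junta_monomial => i ia; apply: zz'; rewrite inE.
  by apply/existsP; exists alpha; rewrite aA.
- apply: l2norm_le; first exact: ltW.
  rewrite (@eq_mean _ _ _ _ (fun z => normc (expansion a' z) ^+ 2)); last first.
    move=> z; congr (normc _ ^+ _); rewrite /expansion /g.
    rewrite (bigID [in A])/= addrAC subrr add0r [RHS](bigID [in A])/=.
    rewrite [X in _ = X + _]big1 ?add0r => [|alpha aA];
      last by rewrite /a' aA mul0r.
    by apply: eq_bigr => alpha /negPf aA; rewrite /a' aA.
  rewrite Parseval//.
  (* Outside A, the squared modulus y^(2d+2) is at most gamma^2 y^(2d), and gamma^2 beta^(2d) =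
     eps^2. *)
  apply: le_trans (_ : \sum_alpha gamma ^+ 2 * y alpha ^+ (2 * d) <= _).
    apply: ler_sum => alpha _; rewrite /a'; case: ifPn => aA.
      by rewrite normc0 expr0n mulr_ge0 ?exprn_ge0 ?(ltW gamma0) ?root_ge0.
    rewrite -[normc _]rootK ?normc_ge0// -exprM mulnC mulnS add2n.
    rewrite 2!exprS mulrA -expr2 ler_wpM2r ?exprn_ge0 ?root_ge0//.
    rewrite ler_sqr ?nnegrE ?root_ge0 ?(ltW gamma0)//.
    by rewrite inE -leNgt in aA.
  rewrite -mulr_sumr.
  apply: le_trans (ler_wpM2l (sqr_ge0 _) ybeta) _; rewrite le_eqVlt; apply/orP;
    left; apply/eqP.
  rewrite /gamma mulnC exprM -exprMn divfK//.
  by rewrite expf_neq0// gt_eqF.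
- have SA : (#|S| <= #|A| * d)%N.
    apply: leq_trans (_ : \sum_(alpha in A) #|support alpha| <= _)%N; last first.
      by rewrite -sum_nat_const leq_sum.
    rewrite -sum1_card.
    under [leqRHS]eq_bigr do rewrite -sum1_card big_mkcond.
    rewrite exchange_big /= big_mkcond leq_sum// => i _.
    rewrite inE; case: ifP => // /existsP[alpha /andP[aA ia]].
    by rewrite (bigD1 alpha)//= ia.
  (* Since beta / gamma = beta^(d+1) / eps = b / eps, it remains to bound the cardinality of A by
     (beta / gamma)^(2d), which is Markov's inequality for the sum of the y^(2d). *)
  have b_eq : b ^+ (2 * d) / eps ^+ (2 * d) = beta ^+ (2 * d) / gamma ^+ (2 * d).
    have -> : b = beta ^+ d.+1 by rewrite rootK// ltW.
    rewrite /gamma expr_div_n invf_div mulrA -exprMn; congr (_ / _).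
    by rewrite [beta * _]mulrC -exprSr.
  apply: le_trans (_ : (#|A| * d)%:R <= _); first by rewrite ler_nat.
  rewrite natrM mulrC -mulrA ler_pM2l ?ltr0n// b_eq ler_pdivlMr ?exprn_gt0//.
  apply: le_trans ybeta; rewrite [leRHS](bigID [in A])/=.
  rewrite mulr_natl -sumr_const -[leLHS]addr0 lerD//.
    apply: ler_sum => alpha; rewrite inE => /ltW ya.
    by rewrite ler_pXn2r ?nnegrE ?muln_gt0 ?root_ge0 ?(ltW gamma0).
  by apply: sumr_ge0 => *; rewrite exprn_ge0 ?root_ge0.
Qed.

End BohnenblustHille.

Theorem proposition5 (R : realType) (K : nat) (hK : (3 <= K)%N) :
  (forall (n d : nat) (f : cube R K n -> R[i]) (eps : R),
     (1 <= n)%N -> (1 <= d)%N ->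
     degree_le d f -> supnorm f <= 1 -> 0 < eps ->
     exists (k : nat) (g : cube R K n -> R[i]),
       [/\ junta k g,
           l2norm (fun z => f z - g z) <= eps &
           ((k%:R : R)%:E <=
              (d%:R : R)%:E * BH R K d ^+ (2 * d) / (eps ^+ (2 * d))%:E)%E])
  /\
  (prime K ->
   exists2 CK : R, 0 < CK &
     forall (n d : nat) (f : cube R K n -> R[i]) (eps : R),
       (1 <= n)%N -> (1 <= d)%N ->
       degree_le d f -> supnorm f <= 1 -> 0 < eps ->
       exists (k : nat) (g : cube R K n -> R[i]),
         [/\ junta k g,
             l2norm (fun z => f z - g z) <= eps &
             k%:R <= eps ^- (2 * d) * d%:R * CK ^+ (d ^ 3)]).
Proof.
have K_gt0 : (0 < K)%N by exact: leq_trans hK.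
split=> [n d f eps n1 d1 [a [fa ad]] f1 eps0|_].
  have fE : f = expansion a by exact/funext.
  have epsd : 0 < eps ^+ (2 * d) by rewrite exprn_gt0.
  have := BH_ge1 R K_gt0 d1.
  have := @BHnorm_le_BH R K K_gt0 n d a n1 d1 ad; rewrite -fE => /(_ f1).
  (* The value -oo is excluded by [BH_ge1]. *)
  case: (BH R K d) => [b| |]; rewrite ?lee_fin// => ab b1.
    have b0 : 0 < b by exact: lt_le_trans b1.
    have [k [g [kg fg kb]]] := BH_junta K_gt0 ad d1 b0 ab eps0.
    exists k, g; rewrite fE; split=> //.
    by rewrite -EFin_expe inver gt_eqF// -!EFinM lee_fin.
  (* If the constant is +oo, so is the bound on k, and f itself serves as an n-junta. *)
  exists n, f; split.
  - exists [set: 'I_n]%SET; first by rewrite cardsT card_ord.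
    by move=> z w zw; congr f; apply/ffunP => i; apply: zw; rewrite inE.
  - apply: (l2norm_le (ltW eps0));
    rewrite (@mean_const _ _ _ (card_Omega_gt0 R K_gt0) _ 0) ?sqr_ge0//.
    by move=> z; rewrite subrr ComplexField.Normc.normc0 expr0n.
  - have -> : (+oo ^+ (2 * d) = +oo :> \bar R)%E.
      have : (0 < 2 * d)%N by rewrite muln_gt0.
      case: (2 * d)%N => // m _.
      by elim: m => [|m IHm]; rewrite expeS ?IHm ?mulyy// expe0 mule1.
    rewrite gt0_muley ?lte_fin ?ltr0n//.
    by rewrite inver gt_eqF// gt0_mulye ?leey// lte_fin invr_gt0.
pose x : R := #|{: seq_sub (Omega R K)}|%:R.
have x1 : 1 <= x by rewrite ler1n card_Omega_gt0.
pose C := 144 * (400 * x ^+ 2).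
have C1 : 1 <= C by rewrite /C; nra.
exists C => [|n d f eps n1 d1 fd f1 eps0]; first exact: lt_le_trans C1.
have Cd m : 0 <= C ^+ m by rewrite exprn_ge0// (le_trans _ C1).
(* For eps >= 1 the zero function is close enough. For eps < 1 the bound of order eps^(-2) is at
   most one of order eps^(-2d), and C^d <= C^(d^3). *)
have [eps1|eps1] := leP 1 eps.
  exists 0%N, (fun=> 0); split.
  - by exists finset.set0; rewrite ?cards0.
  - apply: (l2norm_le (ltW eps0)).
    apply: le_trans (_ : 1 <= _); last by rewrite exprn_ege1.
    rewrite -[leRHS](@mean_const _ 'I_n _ (card_Omega_gt0 R K_gt0) (fun=> 1) 1)//.
    apply: (le_mean (card_Omega_gt0 R K_gt0)) => z.
    rewrite subr0 expr_le1 ?normc_ge0//.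
    exact: le_trans (normc_le_supnorm f z) f1.
  - by rewrite !mulr_ge0// invr_ge0 exprn_ge0// ltW.
have [k [g [kg fg kb]]] := degree_le_junta K_gt0 fd f1 eps0.
exists k, g; split=> //; apply: le_trans kb _; rewrite -/x.
have mulX_le (A B : R) : 1 <= A -> 0 <= B -> A * B ^+ d <= (A * B) ^+ d.
  by move=> A1 B0; rewrite exprMn ler_wpM2r ?exprn_ge0// ler_eXnr.
apply: le_trans (_ : C ^+ d / eps ^+ 2 <= _).
  rewrite ler_wpM2r ?invr_ge0 ?exprn_ge0 ?(ltW eps0)//.
  by apply: mulX_le; [rewrite ler1n|rewrite mulr_ge0 ?sqr_ge0].
apply: le_trans (_ : C ^+ d / eps ^+ (2 * d) <= _).
  rewrite ler_wpM2l// lef_pV2 ?posrE ?exprn_gt0//.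
  by rewrite ler_wiXn2l ?(ltW eps0) ?(ltW eps1)// leq_pmulr.
rewrite [leLHS]mulrC -mulrA ler_wpM2l ?invr_ge0 ?exprn_ge0 ?(ltW eps0)//.
apply: le_trans (_ : C ^+ (d ^ 3) <= _); last by rewrite ler_peMl// ler1n.
by rewrite ler_weXn2l// -[leqLHS]expn1 leq_pexp2l.
Qed.
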